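(* Let $(k,d_1)$ be one of the pairs $(3,3),(3,4),(3,5),(4,3),(5,3)$. Then for no integers $l$ and $d$ with $1<l<k$ and $d\neq d_1$ does a $(k,d_1,d)$-endblock $B(k,l)$ exist.
   Context: All graphs are finite and simple; a planar graph is considered with a fixed plane embedding, and the degree of a face is the length of its boundary walk. A $(k,d_1,d)$-endblock $B(k,l)$ is a $2$-connected plane graph on $n$ vertices such that $n-1$ vertices have degree $k$, one ''exceptional'' vertex $x_1$ has degree $l$ with $1<l<k$, all faces but one have common degree $d_1$, the remaining face has degree $d\neq d_1$, and $x_1$ lies on the boundary of the face of degree $d$. *)

(* Defs.v *)
From mathcomp Require Import all_boot all_fingroup.

Set Implicit Arguments.
Unset Strict Implicit.
Unset Printing Implicit Defensive.

Local Open Scope nat_scope.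

Record sgraph := SGraph {
  svertex :> finType;
  sedge : rel svertex;
  sedge_sym : symmetric sedge;
  sedge_irr : irreflexive sedge
}.

Definition degree (G : sgraph) (x : G) : nat := #|[set y | sedge x y]|.

(* The subgraph induced on A is connected. *)
Definition connected_on (G : sgraph) (A : {set G}) : Prop :=
  {in A &, forall x y,
     connect [rel u v | [&& u \in A, v \in A & sedge u v]] x y}.

(* More than two vertices, and deleting fewer than two vertices never
   disconnects the graph; X = set0 gives connectedness of G itself. *)
Definition two_connected (G : sgraph) : Prop :=
  2 < #|G| /\ forall X : {set G}, #|X| < 2 -> connected_on (~: X).

(* A dart is an edge with a direction: (u, v) runs from u to v. *)
Definition dart (G : sgraph) := {p : G * G | sedge p.1 p.2}.

Definition tail (G : sgraph) (a : dart G) : G := (val a).1.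

Lemma dart_rev_subproof (G : sgraph) (a : dart G) :
  sedge (val a).2 (val a).1.
Proof. by rewrite sedge_sym; exact: (valP a). Qed.

Definition dart_rev (G : sgraph) (a : dart G) : dart G :=
  exist (fun p : G * G => sedge p.1 p.2)
    ((val a).2, (val a).1) (dart_rev_subproof a).

Lemma dart_revK (G : sgraph) : involutive (@dart_rev G).
Proof. by move=> a; apply: val_inj => /=; case: (val a). Qed.

Definition rev_perm (G : sgraph) : {perm dart G} :=
  perm (can_inj (@dart_revK G)).

(* r permutes cyclically the darts issuing from each vertex: each cycle of r
   is the rotation (cyclic order) of the edges around one vertex. *)
Definition is_rotation (G : sgraph) (r : {perm dart G}) : Prop :=
  forall a b : dart G, (b \in porbit r a) = (tail b == tail a).

(* Product of permutations is left-to-right: the dart following a = (u, v)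
   along a face boundary is r (v, u), i.e. the successor of (v, u) in the
   rotation at v. *)
Definition face_perm (G : sgraph) (r : {perm dart G}) : {perm dart G} :=
  (rev_perm G * r)%g.

(* A face is given by its boundary walk, as a cycle of darts; a bridge occurs
   twice on such a walk, once in each direction.  The degree of a face f, the
   length of its boundary walk, is therefore #|f|. *)
Definition faces (G : sgraph) (r : {perm dart G}) : {set {set dart G}} :=
  porbits (face_perm r).

Definition on_boundary (G : sgraph) (x : G) (f : {set dart G}) : Prop :=
  exists2 a : dart G, a \in f & tail a = x.

(* The embedding of a connected graph (with at least one edge) in the plane,
   up to homeomorphism of the sphere: a rotation system whose surface has
   genus 0, that is V - E + F = 2.  The edges are counted as pairs of opposite
   darts.  No face is singled out as the outer one. *)
Record plane_embedding (G : sgraph) := PlaneEmbedding {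
  rotation : {perm dart G};
  rotationP : is_rotation rotation;
  genus0 : #|G| + #|faces rotation| = #|porbits (rev_perm G)| + 2
}.

(* G, embedded by E, is a (k, d1, d)-endblock B(k, l). *)
Definition endblock (k d1 d l : nat) (G : sgraph) (E : plane_embedding G) :
    Prop :=
  [/\ 1 < l < k, d <> d1, two_connected G &
    exists (x1 : G) (f0 : {set dart G}),
      [/\ degree x1 = l,
          forall x : G, x != x1 -> degree x = k,
          f0 \in faces (rotation E) /\ #|f0| = d,
          forall f : {set dart G},
            f \in faces (rotation E) -> f != f0 -> #|f| = d1 &
          on_boundary x1 f0]].

(* Main.v *)
(* Walking along darts, let a finite group generated by an involution E, a rotation P of
   order d1 about a face and the rotation R = P E of order k about a vertex act on a set X.
   Lift the rotation system of G to the product of the darts with X: turning about a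
   vertex acts by R on the second factor, reversing a dart acts by E.  Only at the corner
   between the exceptional vertex and the exceptional face is an extra factor R^(k - l)
   inserted, so that every vertex, every edge and every face but the exceptional one lifts
   to #|X| copies of itself.  Since G has genus 0, the genus inequality for the lift
   shows that it has #|X| components, i.e. that it is a trivial covering; hence the
   lift of the boundary walk of the exceptional face closes up, and R^(k - l) P^d = 1
   on X.  This is impossible if P fixes a point moved by R, ..., R^(k - 1), as happens
   for the rotation group of the Platonic solid of type (k, d1) acting on a suitable
   quotient of the set of its faces. *)

Require Import Defs.
From mathcomp Require Import all_boot all_fingroup.
From mathcomp Require Import zify.

Set Implicit Arguments.
Unset Strict Implicit.
Unset Printing Implicit Defensive.

(** * Orbit counts of permutations and the genus inequality *)

Section Permutations.
Variable T : finType.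
Implicit Types (s t : {perm T}) (x y : T).

Lemma iter_porbit_neq s x i : 0 < i < #|porbit s x| -> iter i s x <> x.
Proof.
case/andP=> i0 ilt e.
have := uniq_traject_porbit s x; case: #|porbit s x| ilt => // n ilt /= /andP[+ _].
move/negP; apply; apply/trajectP; exists i.-1; first by lia.
by rewrite -iterSr prednK.
Qed.

Lemma leq_card_porbits (I : finType) (f : I -> T) s :
  (forall i j, f i \in porbit s (f j) -> i = j) -> #|I| <= #|porbits s|.
Proof.
move=> finj; have injf : injective (fun i => porbit s (f i)).
  by move=> i j eij; apply: finj; rewrite -eij porbit_id.
rewrite -(card_imset predT injf); apply: subset_leq_card.
by apply/subsetP=> _ /imsetP[i _ ->]; apply: imset_f.
Qed.

Lemma porbit_invariant (A : Type) (f : T -> A) s x y :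
  (forall z, f (s z) = f z) -> y \in porbit s x -> f y = f x.
Proof.
move=> fs /porbitP[i ->]; rewrite permX.
by elim: i => //= i IHi; rewrite fs.
Qed.

Lemma porbits_repr s (A : {set T}) x0 :
  A \in porbits s -> A = porbit s (odflt x0 [pick x in A]).
Proof.
case/imsetP=> x _ ->; case: pickP => [y | /(_ x)]; last by rewrite porbit_id.
by rewrite -eq_porbit_mem => /eqP ->.
Qed.

(* The image of [f] stands for the set of components, and this is the genus inequality
   V + E + F <= #|T| + 2 C.  In the induction, multiplying [s] by a transposition of two
   points of one orbit gives one more orbit of [s] and changes the number of orbits of
   [s * t] by one; if that number increases too, putting the transposition back may merge
   two components, which is done by merging two values of [f]. *)
Lemma genus_inequality s t : exists f : T -> {set T},
  [/\ forall x, f (s x) = f x, forall x, f (t x) = f x &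
   #|porbits s| + #|porbits t| + #|porbits (s * t)%g|
     <= #|T| + #|f @: T|.*2].
Proof.
have le_porbits (u : {perm T}) : #|porbits u| <= #|T| by exact: leq_imset_card.
have [n] := ubnP (#|T| - #|porbits s|); elim: n s => // n IHn s les.
have [->|s1] := eqVneq s 1%g.
  exists (porbit t); split=> [x|x|]; first by rewrite perm1.
    by apply/eqP; rewrite eq_porbit_mem (mem_porbit t 1).
  by rewrite mul1g; have := le_porbits 1%g; rewrite /porbits; lia.
have [x sx] : exists x, s x != x.
  apply/existsP; apply: contra_neqT s1 => /existsPn s1.
  by apply/permP=> x; rewrite perm1; apply/eqP; have := s1 x; rewrite negbK.
set y := s x in sx; pose s' : {perm T} := (tperm x y * s)%g.
have cs' : #|porbits s'| = #|porbits s| + 1.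
  have := porbits_mul_tperm s x y; rewrite -/s' /= eq_sym sx.
  by rewrite porbit_sym (mem_porbit s 1) /= addn0.
have [|f [fs ft lef]] := IHn s'; first by have := le_porbits s'; lia.
have es : s = (tperm x y * s')%g by rewrite mulgA tperm2 mul1g.
have := porbits_mul_tperm (s' * t)%g x y; rewrite /= mulgA -es eq_sym sx => cst.
pose f' z := if f z == f y then f x else f z.
have f'xy : f' x = f' y by rewrite /f' eqxx; case: ifP.
exists f'; split=> [z|z|]; last 1 first.
- have : #|f @: T| <= #|f' @: T| + (x \notin porbit (s' * t)%g y).
    have [xy|_] := boolP (x \in porbit (s' * t)%g y).
      have fxy : f x = f y.
        by apply: porbit_invariant xy => z; rewrite permM ft fs.
      rewrite addn0; apply/subset_leq_card/subsetP=> _ /imsetP[z _ ->].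
      by apply/imsetP; exists z; rewrite // /f'; case: eqP => [->|].
    have /subset_leq_card : f @: T \subset f y |: f' @: T.
      apply/subsetP=> _ /imsetP[z _ ->]; rewrite !inE.
      have [//|nz] := eqVneq (f z) (f y).
      by apply/imsetP; exists z => //; rewrite /f' (negPf nz).
    by move/leq_trans; apply; rewrite cardsU1 addnC leq_add2l; case: (_ \notin _).
  move: (x \notin _) cst lef cs' => b.
  move: #|f @: T| #|f' @: T| #|T| #|porbits s| #|porbits s'| #|porbits t|.
  by move: #|porbits (s * t)%g| #|porbits (s' * t)%g| => *; lia.
- have f's u : f' (s' u) = f' u by rewrite /f' fs.
  by rewrite es permM f's; case: tpermP => // ->.
- by rewrite /f' ft.
Qed.

End Permutations.

(** * Permutations of a product lying over a permutation of the first factor *)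

Section Lifts.
Variables (X Y : finType) (S : {perm Y * X}) (s : {perm Y}).
Hypothesis fstS : forall z, (S z).1 = s z.1.

Lemma iter_fst i z : (iter i S z).1 = iter i s z.1.
Proof. by elim: i => //= i IHi; rewrite fstS IHi. Qed.

Lemma porbit_fst z w : w \in porbit S z -> w.1 \in porbit s z.1.
Proof.
by case/porbitP=> i ->; rewrite permX iter_fst -permX mem_porbit.
Qed.

(** A full turn below closes up above, so only the number of steps modulo the length of the base
    orbit matters, and a nonzero remainder moves the base point. *)
Lemma porbit_fiber z w : iter #|porbit s z.1| S z = z ->
  w \in porbit S z -> w.1 = z.1 -> w = z.
Proof.
set n := #|_| => zn /porbitP[i ->]; rewrite permX.
have n0 : 0 < n by rewrite lt0n cards_eq0; apply/set0Pn; exists z.1; exact: porbit_id.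
have iq q : iter (q * n) S z = z.
  by elim: q => //= q IHq; rewrite mulSn iterD IHq.
rewrite (divn_eq i n) addnC iterD iq iter_fst.
case: (posnP (i %% n)) => [-> //|im] e.
by case: (@iter_porbit_neq _ s z.1 (i %% n)) => //; rewrite im ltn_pmod.
Qed.

Lemma iter_lift (Q : X -> X) (a : Y) x i :
    (forall j y, j < i -> S (iter j s a, y) = (s (iter j s a), Q y)) ->
  iter i S (a, x) = (iter i s a, iter i Q x).
Proof.
elim: i => //= i IHi Sj; rewrite IHi => [|j y ji]; last by apply: Sj; lia.
exact: Sj.
Qed.

(** One full turn in which only the step entering [b], the last one, may be irregular. It serves
    both the exceptional vertex and the exceptional face. *)
Lemma iter_lift_last (Q : X -> X) (b : Y) x :
    (forall a y, s a != b -> S (a, y) = (s a, Q y)) ->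
  iter #|porbit s b| S (b, x) =
    S ((s^-1)%g b, iter #|porbit s b|.-1 Q x).
Proof.
move=> Sa; have n0 : 0 < #|porbit s b|.
  by rewrite lt0n cards_eq0; apply/set0Pn; exists b; exact: porbit_id.
have eb : (s^-1)%g b = iter #|porbit s b|.-1 s b.
  by apply: (@perm_inj _ s); rewrite permKV -iterS prednK // iter_porbit.
rewrite -{1}(prednK n0) iterS (@iter_lift Q) ?eb // => j y jn.
apply: Sa; apply/eqP; rewrite -iterS.
by apply: iter_porbit_neq; lia.
Qed.

End Lifts.

(** * Darts, edges and vertex rotations *)

Section Darts.
Variable G : sgraph.
Implicit Types (a b : dart G) (r : {perm dart G}).

Lemma dart_rev_neq a : dart_rev a != a.
Proof.
case: a => [[u v] /= uv]; apply/eqP=> /(congr1 val) /= [vu _].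
by rewrite vu sedge_irr in uv.
Qed.

Lemma porbit_rev a : porbit (rev_perm G) a = [set a; dart_rev a].
Proof.
apply/setP=> b; rewrite !inE; apply/idP/pred2P.
  case/porbitP=> i ->; rewrite permX.
  elim: i => [|i IHi]; first by left.
  by rewrite iterS permE; case: IHi => ->; rewrite ?dart_revK; [right | left].
case=> ->; first exact: porbit_id.
by have := mem_porbit (rev_perm G) 1 a; rewrite expg1 permE.
Qed.

Lemma card_porbit_rev a : #|porbit (rev_perm G) a| = 2.
Proof. by rewrite porbit_rev cards2 eq_sym dart_rev_neq. Qed.

Lemma leq_card_dart : #|{: dart G}| <= #|porbits (rev_perm G)|.*2.
Proof.
have -> : #|{: dart G}| = #|cover (porbits (rev_perm G))|.
  rewrite -cardsT; apply: eq_card => a; rewrite inE; symmetry.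
  apply/bigcupP; exists (porbit (rev_perm G) a); last exact: porbit_id.
  exact: imset_f.
apply: leq_trans (leq_card_cover _) _.
rewrite -muln2 -sum_nat_const; apply: leq_sum => A /imsetP[a _ ->].
by rewrite card_porbit_rev.
Qed.

Lemma card_porbit_rotation r a : is_rotation r -> #|porbit r a| = degree (tail a).
Proof.
move=> rP; have head_inj : {in porbit r a &, injective (fun b => (val b).2)}.
  move=> b c; rewrite !rP => /eqP tb /eqP tc e; apply: val_inj.
  by move: tb tc e; rewrite /tail; case: (val b) (val c) => [b1 b2] [c1 c2] /= -> -> ->.
rewrite -(card_in_imset head_inj); apply: eq_card => y; rewrite !inE.
apply/imsetP/idP => [[b] | ay].
  by rewrite rP => /eqP <- ->; exact: (valP b).
by exists (exist (fun p : G * G => sedge p.1 p.2) (tail a, y) ay) => //; rewrite rP.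
Qed.

End Darts.

(** * The covering argument *)

Lemma no_endblock_of_action (X : finType) (P E : X -> X) (x0 : X) k d1 d l
    (G : sgraph) (emb : plane_embedding G) :
    involutive E -> iter d1 P =1 id -> iter k (P \o E) =1 id -> P x0 = x0 ->
    (forall i, 0 < i < k -> iter i (P \o E) x0 <> x0) ->
  ~ endblock k d1 d l emb.
Proof.
set R := P \o E => EK Pd1 Rk Px0 Rx0.
case=> /andP[l1 lk] _ [_ conn] [x1 [f0 [dx1 dx [f0F cf0] fF [b0 b0f0 tb0]]]].
have {}conn u v : connect (@sedge G) u v.
  have := conn set0; rewrite cards0 => /(_ isT u v).
  rewrite !inE => /(_ isT isT) /connect_sub; apply=> {}u {}v.
  by case/and3P=> _ _; exact: connect1.
case: emb f0F cf0 fF => r rP g0 /= f0F cf0 fF.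
have k0 : 0 < k by lia.
have R_inj : injective R.
  by apply: (can_inj (g := iter k.-1 R)) => x; rewrite -iterSr prednK.
(* The irregular step enters [b0]. Since [face_perm r] applies [r] last, this is one corner, met
   both in the rotation at [x1] and in the walk around [f0]. *)
pose turn a := if r a == b0 then (k - l).+1 else 1.
have rL_inj : injective (fun z : dart G * X => (r z.1, iter (turn z.1) R z.2)).
  move=> [a x] [b y] /= [/perm_inj ->] /eqP.
  by elim: (turn b) => [/= /eqP -> // | i IHi]; rewrite !iterS (inj_eq R_inj).
set e := rev_perm G in g0.
have eL_inj : injective (fun z : dart G * X => (e z.1, E z.2)).
  by move=> [a x] [b y] /= [/perm_inj -> /(can_inj EK) ->].
pose lift := {perm dart G * X}.
pose rL : lift := perm rL_inj; pose eL : lift := perm eL_inj; pose fL : lift := (eL * rL)%g.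
set f := face_perm r; rewrite /faces -/f in f0F fF g0.
have rL1 z : (rL z).1 = r z.1 by rewrite permE.
have eL1 z : (eL z).1 = e z.1 by rewrite permE.
have fL1 z : (fL z).1 = f z.1 by rewrite !permM rL1 eL1.
have rLE a x : r a != b0 -> rL (a, x) = (r a, R x).
  by move=> /negPf ab; rewrite permE /= /turn ab.
have fLE a x : f a != b0 -> fL (a, x) = (f a, P x).
  rewrite /f !permM => ab; rewrite [eL _]permE /= rLE //.
  by rewrite /R /= EK.
have rLb0 x : rL ((r^-1)%g b0, x) = (b0, iter (k - l).+1 R x).
  by rewrite permE /= /turn permKV eqxx.
have fLb0 x : fL ((f^-1)%g b0, x) = (b0, iter (k - l) R (P x)).
  rewrite permM [eL _]permE /= permE /= /turn.
  have -> : r (e ((f^-1)%g b0)) = f ((f^-1)%g b0) by rewrite [RHS]permM.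
  by rewrite permKV eqxx iterSr /R /= EK.
have ef0 : f0 = porbit f b0.
  by case/imsetP: f0F b0f0 => a _ -> ba; apply/eqP; rewrite eq_sym eq_porbit_mem.
have [phi [phi_e phi_r le_phi]] := genus_inequality eL rL.
have phi_it u i z : (forall w, phi (u w) = phi w) -> phi (iter i u z) = phi z.
  by move=> phiu; elim: i => //= i <-.
have phi_f z : phi (fL z) = phi z by rewrite permM phi_r phi_e.
have phi_turn a b x : tail a = tail b -> exists y, phi (a, x) = phi (b, y).
  move=> ab; have /porbitP[i ->] : b \in porbit r a by rewrite rP ab.
  exists (iter i rL (a, x)).2; rewrite -(phi_it rL i) // permX.
  by congr phi; rewrite [LHS]surjective_pairing (iter_fst rL1).
(* Connectedness of [G] lets every value of [phi] be attained over the single dart [b0]. *)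
have phi_b0 a x : exists y, phi (a, x) = phi (b0, y).
  have /connectP[p] := conn (tail b0) (tail a).
  elim/last_ind: p a x => [|p u IHp] a x; first by move=> _ /= /phi_turn.
  rewrite rcons_path last_rcons => /andP[pp uv] eu; subst u.
  pose c : dart G := exist (fun p : G * G => sedge p.1 p.2) (_, _) uv.
  have [y ->] := @phi_turn a (e c) x ltac:(by rewrite permE).
  have -> : phi (e c, y) = phi (c, E y).
    by rewrite -(phi_e (e c, y)) permE /= !permE dart_revK.
  exact: (IHp c).
have phi_onto : phi @: predT = (fun x => phi (b0, x)) @: X.
  apply/setP=> A; apply/imsetP/imsetP=> [[[a x] _ ->] | [x _ ->]].
    by have [y ->] := phi_b0 a x; exists y.
  by exists (b0, x).
have tail_r a : tail (r a) = tail a.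
  by apply/eqP; rewrite -rP -{1}(expg1 r) mem_porbit.
have dart_of v : exists a : dart G, tail a == v.
  have : 0 < degree v.
    by have [->|/dx ->//] := eqVneq v x1; rewrite dx1; lia.
  rewrite card_gt0 => /set0Pn[u]; rewrite inE => vu.
  by exists (exist (fun p : G * G => sedge p.1 p.2) (v, u) vu).
have vertices : #|G| * #|X| <= #|porbits rL|.
  (* At [x1] the turn must start from [b0]: then [l - 1] regular steps and a last one by [R] to the
     power [k - l + 1] add up to [R] to the power [k]. *)
  pose rep v := if v == x1 then b0 else xchoose (dart_of v).
  have tail_rep v : tail (rep v) = v.
    by rewrite /rep; case: eqP => [-> // | _]; apply/eqP/(xchooseP (dart_of v)).
  have close v x : iter #|porbit r (rep v)| rL (rep v, x) = (rep v, x).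
    have [vx1|nv] := eqVneq v x1.
      have -> : rep v = b0 by rewrite /rep vx1 eqxx.
      rewrite (iter_lift_last _ rLE) rLb0 -(iterD _ _ R) card_porbit_rotation // tb0 dx1.
      have -> : (k - l).+1 + l.-1 = k by lia.
      by rewrite Rk.
    rewrite (@iter_lift _ _ _ r R) ?iter_porbit => [|j y _].
      by rewrite card_porbit_rotation // tail_rep dx // Rk.
    apply: rLE; apply: contra_neq nv => rb; rewrite -(tail_rep v) -tb0 -rb tail_r.
    by elim: j {rb} => //= j ->.
  rewrite -card_prod; apply: (leq_card_porbits (f := fun i => (rep i.1, i.2))).
  move=> [v x] [w y] /= vw.
  have := porbit_fst rL1 vw; rewrite rP /= !tail_rep => /eqP vEw; subst w.
  by case: (porbit_fiber rL1 (z := (rep v, y)) (close v y) vw erefl) => ->.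
have edges : #|porbits e| * #|X| <= #|porbits eL|.
  pose rep (A : {set dart G}) := odflt b0 [pick a in A].
  have -> : #|porbits e| = #|{: {A | A \in porbits e}}| by rewrite card_sig.
  rewrite -card_prod.
  apply: (leq_card_porbits (f := fun i => (rep (val i.1), i.2))).
  move=> [A x] [B y] /= AB.
  have AeB : A = B.
    apply: val_inj; rewrite (porbits_repr b0 (valP A)) (porbits_repr b0 (valP B)).
    by apply/eqP; rewrite eq_porbit_mem; exact: porbit_fst AB.
  subst B; have := porbit_fiber eL1 _ AB erefl.
  rewrite card_porbit_rev /=; have -> z : eL (eL z) = z; last by move=> /(_ erefl)[->].
  by rewrite !permE /= dart_revK EK; case: z.
(* Over [f0] the lifted walk is not yet known to close, so only one orbit per value of [phi] is
   counted there. *)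
have all_faces : #|porbits f :\ f0| * #|X| + #|phi @: predT| <= #|porbits fL|.
  pose rep (A : {set dart G}) := odflt b0 [pick a in A].
  pose rhs := {x : {set dart G * X} | x \in phi @: predT}.
  have repA A : A \in porbits f :\ f0 -> A = porbit f (rep A).
    by rewrite !inE => /andP[_]; exact: porbits_repr.
  have close A x : A \in porbits f :\ f0 ->
      iter #|porbit f (rep A)| fL (rep A, x) = (rep A, x).
    move=> AF; rewrite (@iter_lift _ _ _ f P) ?iter_porbit => [|j y _].
      rewrite -(repA A AF) fF ?Pd1 //; first by move: AF; rewrite !inE => /andP[].
      by move: AF; rewrite !inE => /andP[].
    apply: fLE; apply/eqP=> fb; case/setD1P: (AF) => /eqP[].
    by rewrite ef0 -fb -iterS -permX porbit_perm; exact: repA.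
  have choose (B : rhs) : exists x, phi (b0, x) == val B.
    by case: B => B /=; rewrite phi_onto => /imsetP[x _ ->]; exists x.
  have -> : #|porbits f :\ f0| = #|{: {A | A \in porbits f :\ f0}}| by rewrite card_sig.
  have -> : #|phi @: predT| = #|{: rhs}| by rewrite card_sig.
  rewrite -card_prod -card_sum.
  apply: (leq_card_porbits (f := fun i => match i with
    | inl (A, x) => (rep (val A), x)
    | inr B => (b0, xchoose (choose B))
    end)).
  have notf0 (A : {A | A \in porbits f :\ f0}) : rep (val A) \notin porbit f b0.
    have := valP A; rewrite !inE => /andP[nA _]; apply: contra nA.
    by rewrite -eq_porbit_mem -(repA _ (valP A)) -ef0.
  move=> [[A x]|A] [[B y]|B] AB; have /= := porbit_fst fL1 AB.
  - rewrite -eq_porbit_mem -(repA _ (valP A)) -(repA _ (valP B)) => /eqP/val_inj AeB.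
    by subst B; case: (porbit_fiber fL1 (z := (_, y)) (close _ y (valP A)) AB erefl) => ->.
  - by rewrite (negPf (notf0 A)).
  - by rewrite porbit_sym (negPf (notf0 B)).
  move=> _; congr inr; apply: val_inj.
  rewrite -(eqP (xchooseP (choose A))) -(eqP (xchooseP (choose B))).
  exact: porbit_invariant phi_f AB.
have cardF : #|porbits f| = #|porbits f :\ f0|.+1 by rewrite (cardsD1 f0) f0F.
have phi_inj : {in X &, injective (fun x => phi (b0, x))}.
  apply/imset_injP; rewrite eqn_leq leq_imset_card /= -phi_onto.
  (* With [g0], the counts and the genus inequality leave [#|X| <= #|phi @: predT|]. *)
  move: le_phi vertices edges all_faces (leq_mul (leq_card_dart G) (leqnn #|X|)).
  rewrite -/e card_prod -/fL; move: g0; rewrite cardF.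
  move: #|porbits eL| #|porbits rL| #|porbits fL| #|phi @: predT| #|_ :\ f0|.
  move: #|{: dart G}| #|X| #|G| #|porbits e| => D x V Ed eL' rL' fL' p F.
  by rewrite -!muln2; nia.
(* The lifted walk around [f0] from [(b0, x0)] returns over [b0] with the same [phi], hence to its
   start; as [P] fixes [x0], so does [R] to the power [k - l]. *)
apply: (Rx0 (k - l)); first by lia.
apply: phi_inj => //.
have := phi_it fL #|porbit f b0| (b0, x0) phi_f.
rewrite (iter_lift_last _ fLE) fLb0 -iterS => <-; congr (phi (_, iter _ _ _)).
by elim: _.+1 => //= i <-.
Qed.

(** * Explicit actions for the five pairs *)

Definition table n (s : seq nat) (i : 'I_n.+1) : 'I_n.+1 := inord (nth 0 s i).

Ltac check_table :=
  first [ by case=> [[|[|[|[|[|[|//]]]]]] //= ?]; apply/val_inj; rewrite /table /= !inordK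
        | by apply/val_inj; rewrite /table /= !inordK
        | by case=> [|[|[|[|[|//]]]]] // _ /(congr1 val); rewrite /table /= !inordK ].

Theorem theorem17 (k d1 : nat)
    (hkd : (k, d1) \in [:: (3, 3); (3, 4); (3, 5); (4, 3); (5, 3)])
    (l d : nat) (hl : 1 < l < k) (hd : d <> d1) :
  ~ exists (G : sgraph) (E : plane_embedding G), endblock k d1 d l E.
Proof.
case=> G [emb].
(* The point [x0] is the last one, which each table [p] below fixes. *)
have no_table n p e := @no_endblock_of_action 'I_n.+1 (table p) (table e)
  ord_max k d1 d l G emb.
(* Rotation groups of the Platonic solids: A4 on 4 points, S4 on 3, A5 on 6, S4 on 4
   and A5 on 5.  The first three are the actions of PSL2(Z) on the projective lines
   over F_3, F_2, F_5, by z + 1 and - 1 / z, with the point at infinity last. *)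
move: hkd; rewrite !inE !xpair_eqE.
case/or4P=> [|||/orP[]] /andP[/eqP ek /eqP ed1]; subst k d1.
- by apply: (no_table 3 [:: 1; 2; 0; 3] [:: 3; 2; 1; 0]); check_table.
- by apply: (no_table 2 [:: 1; 0; 2] [:: 2; 1; 0]); check_table.
- by apply: (no_table 5 [:: 1; 2; 3; 4; 0; 5] [:: 5; 4; 2; 3; 1; 0]); check_table.
- by apply: (no_table 3 [:: 1; 2; 0; 3] [:: 3; 1; 2; 0]); check_table.
- by apply: (no_table 4 [:: 1; 2; 0; 3; 4] [:: 3; 4; 2; 0; 1]); check_table.
Qed.
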